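(* Let $\delta>0$, let $y^\delta\in Y$ satisfy $\|y^\delta-y\|\le\delta$, and consider the noisy-data RESESOP algorithm described in the context, in which for each $n$ the current gradient $g_n^\delta=F'(x_n^\delta)^*(F(x_n^\delta)-y^\delta)$ is contained in the search space of iteration $n$. If the parameter $\tau$ is chosen such that $$\tau>\frac{1+c_{\mathrm{tc}}}{1-c_{\mathrm{tc}}},$$ then the discrepancy principle yields a finite stopping index $n_*=n_*(\delta)$, i.e. there is $n\in\mathbb{N}$ with $\|F(x_n^\delta)-y^\delta\|\le\tau\delta$, and $n_*(\delta)=\min\{n\in\mathbb{N}:\|F(x_n^\delta)-y^\delta\|\le\tau\delta\}$ is finite.
   Context: Setting. $X,Y$ are real Hilbert spaces, $F:\mathcal{D}(F)\subset X\to Y$ is a (nonlinear) operator, $y\in Y$ is exact data, $M_{F(x)=y}=\{x:F(x)=y\}$. $B_r(a)$ denotes the closed ball of radius $r$ about $a$. $F$ is continuous and Fr\'echet differentiable in a ball $B_\rho(x_0)\subset\mathcal{D}(F)$, $\rho>0$, with continuous Fr\'echet derivative $F'$; $F'(x)^*:Y\to X$ denotes the Hilbert space adjoint of $F'(x)$. There is a solution $x^+\in B_{\rho/2}(x_0)$ of $F(x)=y$. The tangential cone condition holds: there is a constant $0\le c_{\mathrm{tc}}<1$ with $\|F(x)-F(\tilde x)-F'(x)(x-\tilde x)\|\le c_{\mathrm{tc}}\|F(x)-F(\tilde x)\|$ for all $x,\tilde x\in B_\rho(x_0)$. There is $c_F>0$ with $\|F'(x)\|<c_F$ for all $x\in B_\rho(x_0)$.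 $F$ is weakly sequentially closed: if $x_n\rightharpoonup x$ and $F(x_n)\to y'$, then $x\in\mathcal{D}(F)$ and $F(x)=y'$. For $u\in X$, $\alpha\in\mathbb{R}$, $\xi\ge 0$ the stripe is $H(u,\alpha,\xi):=\{x\in X: |\langle u,x\rangle-\alpha|\le\xi\}$. Noisy-data RESESOP algorithm. Start with $x_0^\delta:=x_0$ and a constant $\tau>1$. Put $R_n^\delta:=F(x_n^\delta)-y^\delta$. At iteration $n\in\mathbb{N}$ (starting with $n=0$) choose a finite index set $I_n^\delta\subset\{0,\dots,n\}$ with $n\in I_n^\delta$ and elements $w_{n,i}^\delta\in Y$, $i\in I_n^\delta$, with $w_{n,n}^\delta=R_n^\delta$; the search directions are $u_{n,i}^\delta:=F'(x_i^\delta)^*w_{n,i}^\delta$ and the search space is $\{u_{n,i}^\delta:i\in I_n^\delta\}$. If $\|R_n^\delta\|\le\tau\delta$ (discrepancy principle), stop. Otherwise compute $$x_{n+1}^\delta=x_n^\delta-\sum_{i\in I_n^\delta}t_{n,i}^\delta F'(x_i^\delta)^*w_{n,i}^\delta,$$ where the real parameters $t_{n,i}^\delta$ are chosen such that $$x_{n+1}^\delta\in\bigcap_{i\in I_n^\delta}H(u_{n,i}^\delta,\alpha_{n,i}^\delta,\xi_{n,i}^\delta),$$ with $\alpha_{n,i}^\delta:=\langle F'(x_i^\delta)^*w_{n,i}^\delta,x_i^\delta\rangle-\langle w_{n,i}^\delta,F(x_i^\delta)-y^\delta\rangle$ and $\xi_{n,i}^\delta:=\bigl(\delta+c_{\mathrm{tc}}(\|R_i^\delta\|+\delta)\bigr)\|w_{n,i}^\delta\|$,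 and such that an estimate of the form $\|z-x_{n+1}^\delta\|^2\le\|z-x_n^\delta\|^2-C\|R_n^\delta\|^2$ holds for all $z\in M_{F(x)=y}$, for some constant $C>0$ (independent of $n$ and $z$). *)

(* Defs.v *)
From HB Require Import structures.
From mathcomp Require Import all_boot all_order all_algebra.
From mathcomp Require Import sesquilinear.
From mathcomp Require Import all_classical all_reals all_analysis.

Set Implicit Arguments.
Unset Strict Implicit.
Unset Printing Implicit Defensive.

Import Order.TTheory GRing.Theory Num.Theory.
Import numFieldNormedType.Exports.

Local Open Scope classical_set_scope.
Local Open Scope ring_scope.

HB.mixin Record CompleteNormedModule_isHilbert (R : realType) X
    of CompleteNormedModule R X := {
  hdot : {dot X for (@idfun R)} ;
  hdotE : forall x : X, `|x| = Num.sqrt (hdot x x)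
}.

#[short(type="hilbertType")]
HB.structure Definition Hilbert (R : realType) :=
  {X of CompleteNormedModule R X & CompleteNormedModule_isHilbert R X}.

Reserved Notation "⟨ u , v ⟩" (at level 0, format "⟨ u ,  v ⟩").
Notation "⟨ u , v ⟩" := (hdot u v) : ring_scope.

Section Operators.
Context {R : realType} {X Y : hilbertType R}.

Definition opnorm (A : X -> Y) : R :=
  sup [set `|A h| | h in [set h : X | `|h| <= 1]].

(* For a continuous linear A, the vector selected here exists (Riesz) and is
   unique. *)
Definition adjoint (A : X -> Y) (v : Y) : X :=
  xget 0 [set u : X | forall h : X, ⟨A h, v⟩ = ⟨h, u⟩].

(* F is only meaningful on its domain D, and x may lie on the boundary of D, so
   the limit is taken along D; at interior points of D this is the usual Fréchet derivative. *)
Definition is_frechet_derivative (D : set X) (F : X -> Y) (x : X)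
    (A : {linear X -> Y}) : Prop :=
  continuous A /\
  forall eps : R, 0 < eps -> \forall z \near within D (nbhs x),
    `|F z - F x - A (z - x)| <= eps * `|z - x|.

Definition weak_cvg (u : nat -> X) (x : X) : Prop :=
  forall f : {linear X -> R^o}, continuous f -> f \o u @ \oo --> f x.

Definition weakly_sequentially_closed (D : set X) (F : X -> Y) : Prop :=
  forall (u : nat -> X) (x : X) (y : Y), (forall n, D (u n)) ->
    weak_cvg u x -> F \o u @ \oo --> y -> D x /\ F x = y.

Definition tangential_cone (B : set X) (F : X -> Y) (dF : X -> {linear X -> Y})
    (c : R) : Prop :=
  forall x x' : X, B x -> B x' ->
    `|F x - F x' - dF x (x - x')| <= c * `|F x - F x'|.

Definition solution_set (D : set X) (F : X -> Y) (y : Y) : set X :=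
  [set x | D x /\ F x = y].

Definition stripe (u : X) (alpha xi : R) : set X :=
  [set x | `|⟨u, x⟩ - alpha| <= xi].

End Operators.

Section Resesop.
Context {R : realType} {X Y : hilbertType R}.
Variables (D : set X) (F : X -> Y) (dF : X -> {linear X -> Y}) (y : Y) (x0 : X).
Variables (ctc delta tau : R) (yd : Y).
(* Iterates, index sets I n ⊂ {0, ..., n}, vectors w n i, parameters t n i.
   The values of x after the stopping index are unconstrained. *)
Variables (x : nat -> X) (I : forall n, {set 'I_n.+1}).
Variables (w : forall n, 'I_n.+1 -> Y) (t : forall n, 'I_n.+1 -> R).
Implicit Types n : nat.

Definition residual n : Y := F (x n) - yd.

Definition discrepancy n : Prop := `|residual n| <= tau * delta.

(* Iteration n is entered. *)
Definition reached n : Prop := forall k, (k < n)%N -> ~ discrepancy k.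

Definition search_dir n (i : 'I_n.+1) : X := adjoint (dF (x i)) (w i).

Definition gradient n : X := adjoint (dF (x n)) (residual n).

Definition stripe_offset n (i : 'I_n.+1) : R :=
  ⟨search_dir i, x i⟩ - ⟨w i, residual i⟩.

Definition stripe_width n (i : 'I_n.+1) : R :=
  (delta + ctc * (`|residual i| + delta)) * `|w i|.

Definition resesop_choice n : Prop :=
  ord_max \in I n /\ w (@ord_max n) = residual n.

Definition resesop_step n : Prop :=
  x n.+1 = x n - \sum_(i in I n) t i *: search_dir i /\
  forall i, i \in I n ->
    stripe (search_dir i) (stripe_offset i) (stripe_width i) (x n.+1).

Definition descent (C : R) n : Prop :=
  forall z, solution_set D F y z ->
    `|z - x n.+1| ^+ 2 <= `|z - x n| ^+ 2 - C * `|residual n| ^+ 2.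

Definition resesop : Prop :=
  [/\ 1 < tau, x 0%N = x0,
      forall n, reached n -> resesop_choice n,
      forall n, reached n.+1 -> resesop_step n &
      exists2 C, 0 < C & forall n, reached n.+1 -> descent C n].

Definition gradient_in_search_space : Prop :=
  forall n, reached n -> exists2 i, i \in I n & search_dir i = gradient n.

End Resesop.

(* Main.v *)
(* Every step before the discrepancy principle is met lowers the squared
   distance to a solution by at least C (tau delta)^2 > 0, so there are only
   finitely many such steps.  The distance to a solution in the ball of radius
   rho / 2 never increases, which keeps the iterates in the ball of radius rho. *)
Require Import Defs.
From mathcomp Require Import all_boot all_order all_algebra.
From mathcomp Require Import all_classical all_reals all_analysis.
From mathcomp Require Import lra.

Import Order.TTheory GRing.Theory Num.Theory.
Import numFieldNormedType.Exports.

Local Open Scope classical_set_scope.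
Local Open Scope ring_scope.

Section FiniteStopping.
Context {R : realType} {X Y : hilbertType R}.
Context {D : set X} {F : X -> Y} {y : Y} {delta tau : R} {yd : Y}.
Context {x : nat -> X} {C : R}.

Lemma reachedW {n} : reached F delta tau yd x n.+1 -> reached F delta tau yd x n.
Proof. by move=> rn k kn; apply: rn; exact: ltnW. Qed.

(** Induction on [n]: [reached] at [n.+1] includes the failure of the discrepancy principle at [n],
    so the residual in [descent] may be replaced by its lower bound [tau * delta]. *)
Lemma sqr_dist_solution_descent {z : X} {n} :
  0 <= C -> 0 <= tau * delta -> solution_set D F y z ->
  (forall k, reached F delta tau yd x k.+1 -> descent D F y yd x C k) ->
  reached F delta tau yd x n ->
  `|z - x n| ^+ 2 <= `|z - x 0| ^+ 2 - C * (tau * delta) ^+ 2 *+ n.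
Proof.
move=> C0 td0 zsol desc; elim: n => [|n IH] rn; first by rewrite mulr0n subr0.
have := IH (reachedW rn); have := desc n rn z zsol.
have /negP : ~ `|residual F yd x n| <= tau * delta by exact: rn.
rewrite -ltNge => /ltW res_gt.
have : C * (tau * delta) ^+ 2 <= C * `|residual F yd x n| ^+ 2.
  by rewrite ler_wpM2l// lerXn2r// nnegrE.
by rewrite mulrSr; lra.
Qed.

(** If the principle were never met, every index would be reached and the bound of
    [sqr_dist_solution_descent], which is affine and decreasing in [n], would force a negative
    square. *)
Lemma discrepancy_ex {z : X} :
  0 < C -> 0 < tau * delta -> solution_set D F y z ->
  (forall k, reached F delta tau yd x k.+1 -> descent D F y yd x C k) ->
  exists n, discrepancy F delta tau yd x n.
Proof.
move=> C0 td0 zsol desc; apply: contrapT => /forallNP never.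
have c0 : 0 < C * (tau * delta) ^+ 2 by rewrite mulr_gt0// exprn_gt0.
(* By the Archimedean property this [n] exceeds the number of decrements that fit into the initial
   squared distance. *)
pose n := Num.bound (`|z - x 0| ^+ 2 / (C * (tau * delta) ^+ 2)).
have : `|z - x 0| ^+ 2 < C * (tau * delta) ^+ 2 *+ n.
  rewrite -mulr_natl -ltr_pdivrMr// /n archi_boundP//.
  by rewrite divr_ge0// ?sqr_ge0// ltW.
have rn : reached F delta tau yd x n by move=> k _; exact: never.
have := sqr_dist_solution_descent (ltW C0) (ltW td0) zsol desc rn.
have := sqr_ge0 `|z - x n|; lra.
Qed.

End FiniteStopping.

Theorem theorem4p8 (R : realType) (X Y : hilbertType R)
  (D : set X) (F : X -> Y) (dF : X -> {linear X -> Y}) (y : Y)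
  (x0 : X) (rho : R) (hrho : 0 < rho)
  (hD : closed_ball x0 rho `<=` D)
  (hFcont : {within closed_ball x0 rho, continuous F})
  (hdF : forall x : X, closed_ball x0 rho x -> is_frechet_derivative D F x (dF x))
  (hdFcont : forall x : X, closed_ball x0 rho x ->
    opnorm (fun h => dF z h - dF x h)
      @[z --> within (closed_ball x0 rho) (nbhs x)] --> (0 : R))
  (hsol : exists xp : X, closed_ball x0 (rho / 2) xp /\ F xp = y)
  (ctc : R) (hctc0 : 0 <= ctc) (hctc1 : ctc < 1)
  (htc : tangential_cone (closed_ball x0 rho) F dF ctc)
  (cF : R) (hcF : 0 < cF)
  (hdFbound : forall x : X, closed_ball x0 rho x -> opnorm (dF x) < cF)
  (hwsc : weakly_sequentially_closed D F)
  (delta : R) (hdelta : 0 < delta)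
  (yd : Y) (hyd : `|yd - y| <= delta)
  (tau : R)
  (x : nat -> X) (I : forall n : nat, {set 'I_n.+1})
  (w : forall n : nat, 'I_n.+1 -> Y) (t : forall n : nat, 'I_n.+1 -> R)
  (halg : resesop D F dF y x0 ctc delta tau yd x I w t)
  (hgrad : gradient_in_search_space F dF delta tau yd x I w)
  (htau : (1 + ctc) / (1 - ctc) < tau) :
  exists n : nat,
    [/\ D (x n), `|F (x n) - yd| <= tau * delta &
        forall m : nat, `|F (x m) - yd| <= tau * delta -> (n <= m)%N].
Proof.
have [tau1 x0E _ _ [C C0 desc]] := halg.
have td0 : 0 < tau * delta by rewrite mulr_gt0// (lt_trans ltr01).
have [xp [xp_ball Fxp]] := hsol.
have rho20 : 0 < rho / 2 by rewrite divr_gt0.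
have xp_near : `|x0 - xp| <= rho / 2 by move: xp_ball; rewrite closed_ballE.
have xp_sol : solution_set D F y xp.
  by split=> //; apply: hD; rewrite closed_ballE//= /closed_ball_ /=; lra.
have exn : exists n, `[< discrepancy F delta tau yd x n >].
  have [n nP] := discrepancy_ex C0 td0 xp_sol desc.
  by exists n; exact/asboolP.
case: (ex_minnP exn) => n /asboolP nP nmin; exists n; split=> //; last first.
  by move=> m mP; apply: nmin; exact/asboolP.
(* Minimality of [n] rules out earlier stopping, so the descent estimate applies to every step
   leading to [x n]. *)
have rn : reached F delta tau yd x n.
  by move=> k kn /asboolP/nmin; rewrite leqNgt kn.
have := sqr_dist_solution_descent (ltW C0) (ltW td0) xp_sol desc rn.
rewrite x0E => sq_le.
have dist_le : `|xp - x n| <= `|xp - x0|.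
  rewrite -ler_sqr ?nnegrE//; apply: (le_trans sq_le).
  by rewrite gerBl mulrn_wge0// mulr_ge0 ?sqr_ge0// ltW.
(* Triangle inequality through [xp]: both [x0] and [x n] lie within [rho / 2] of it, so [x n] is
   within [rho] of [x0]. *)
apply: hD; rewrite closed_ballE//= /closed_ball_ /=.
have := ler_distD xp x0 (x n); move: dist_le; rewrite (distrC xp x0); lra.
Qed.
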